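(* At each point $x\in M$, the $\mathcal{FF}^{PD}_g$-Finsleroid indicatrix $\{y\in T_xM:K(x,y)=1\}$ is globally isometric to the Euclidean sphere of radius $$r=\frac1h\equiv\frac1{\sqrt{1-\frac14g^2}} .$$
   Context: $M$ is an $N$-dimensional manifold with Riemannian metric $a_{ij}(x)$ and a 1-form $b=b_i(x)y^i$ of unit length, $a_{ij}b^ib^j=1$, $b^i=a^{ij}b_j$. Let $g=g(x)$ be a scalar with $-2<g<2$ and $h=\sqrt{1-g^2/4}$. Put $q=\sqrt{(a_{mn}-b_mb_n)y^my^n}$, $A=b+\frac12gq$, $B=b^2+gbq+q^2$, $f=\arccos(A/\sqrt B)\in[0,\pi]$, $\chi=f/h$. The $\mathcal{FF}^{PD}_g$-Finsleroid metric function is $K(x,y)=\sqrt B\,e^{-\frac12g\chi}$, with metric tensor $g_{ij}=\frac12\partial^2K^2/\partial y^i\partial y^j$ (which extends continuously to the axis directions $y=\pm b$, where $K$ is of class $C^2$). The indicatrix carries the Riemannian metric induced from the tangent Riemannian space $(T_xM,g_{ij}(x,\cdot))$ ($x$ fixed). *)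

(* Defs.v *)
(* Built on MathComp-Analysis; R is an arbitrary realType. *)
From HB Require Import structures.
From mathcomp Require Import all_boot all_order all_algebra.
From mathcomp Require Import all_classical all_reals all_analysis.

Set Implicit Arguments.
Unset Strict Implicit.
Unset Printing Implicit Defensive.
Import Order.TTheory GRing.Theory Num.Theory.
Import numFieldNormedType.Exports.
Local Open Scope classical_set_scope.
Local Open Scope ring_scope.

(* [f] is of class C^k on [U]; only meaningful for open [U]. *)
Fixpoint class_C (R : realType) (n : nat) (V : normedModType R) (k : nat)
    (U : set 'rV[R]_n) (f : 'rV[R]_n -> V) {struct k} : Prop :=
  (forall p, U p -> {for p, continuous f}) /\
  match k with
  | 0%N => True
  | k'.+1 => forall i : 'I_n,
      (forall p, U p -> derivable f p (delta_mx 0 i)) /\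
      class_C k' U (fun p => 'D_(delta_mx 0 i) f p)
  end.

Definition smooth (R : realType) (n : nat) (V : normedModType R)
    (U : set 'rV[R]_n) (f : 'rV[R]_n -> V) : Prop :=
  forall k, class_C k U f.

Definition bilin (R : realType) (n : nat) (A : 'M[R]_n) (v w : 'rV[R]_n) : R :=
  (v *m A *m w^T) 0 0.

Definition posdef (R : realType) (n : nat) (A : 'M[R]_n) : Prop :=
  A^T = A /\ forall v : 'rV[R]_n, v != 0 -> 0 < bilin A v v.

(* [coord i] and [param i] are total functions, mutually inverse only between
   [dom i] and its image. *)
Record smooth_manifold (R : realType) (n : nat) := SmoothManifold {
  carrier :> topologicalType;
  chart : Type;
  dom : chart -> set carrier;
  coord : chart -> carrier -> 'rV[R]_n;
  param : chart -> 'rV[R]_n -> carrier;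
  mf_hausdorff : hausdorff_space carrier;
  mf_countable : @second_countable carrier;
  mf_cover : forall x, exists i, dom i x;
  mf_dom_open : forall i, open (dom i);
  mf_image_open : forall i, open (coord i @` dom i);
  mf_coordK : forall i x, dom i x -> param i (coord i x) = x;
  mf_coord_cont : forall i x, dom i x -> {for x, continuous (coord i)};
  mf_param_cont : forall i u, (coord i @` dom i) u ->
    {for u, continuous (param i)};
  mf_transition : forall i j,
    smooth (coord i @` (dom i `&` dom j)) (coord j \o param i) }.

(* Tensor fields are given by their components in each chart. Tangent vectors
   have as components a row vector, so the Jacobian [J] of the change of chart
   from [i] to [j] (in the row convention of [jacobian]) transforms the
   components by [v |-> v *m J]. *)
Definition transition_jacobian (R : realType) (n : nat)
    (M : smooth_manifold R n) (i j : chart M) (x : M) : 'M[R]_n :=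
  jacobian (@coord R n M j \o @param R n M i) (coord i x).

Record riemannian_metric (R : realType) (n : nat) (M : smooth_manifold R n) :=
  RiemannianMetric {
  rm_comp :> chart M -> M -> 'M[R]_n;
  rm_posdef : forall i x, dom i x -> posdef (rm_comp i x);
  rm_smooth : forall i,
    smooth (coord i @` dom i) (fun u => rm_comp i (param i u));
  rm_tensor : forall i j x, dom i x -> dom j x ->
    rm_comp i x = transition_jacobian i j x *m rm_comp j x
                    *m (transition_jacobian i j x)^T }.

Record one_form (R : realType) (n : nat) (M : smooth_manifold R n) :=
  OneForm {
  of_comp :> chart M -> M -> 'rV[R]_n;
  of_smooth : forall i,
    smooth (coord i @` dom i) (fun u => of_comp i (param i u));
  of_tensor : forall i j x, dom i x -> dom j x ->
    of_comp i x = of_comp j x *m (transition_jacobian i j x)^T }.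

(* Here [a = (a_ij)], [b = (b_i)] and [g] are the values at a fixed point, and
   [y] is the row of components of a tangent vector at that point. *)
Section Finsleroid.
Variables (R : realType) (n : nat) (a : 'M[R]_n) (b : 'rV[R]_n) (g : R).
Implicit Type y : 'rV[R]_n.

(* b^i = a^{ij} b_j *)
Definition raise_index : 'rV[R]_n := \row_i \sum_j invmx a i j * b 0 j.
Definition covector_sqnorm : R := bilin a raise_index raise_index.

Definition fins_h : R := Num.sqrt (1 - g ^+ 2 / 4).
Definition fins_b y : R := \sum_i b 0 i * y 0 i.
Definition fins_q y : R :=
  Num.sqrt (\sum_i \sum_j (a i j - b 0 i * b 0 j) * y 0 i * y 0 j).
Definition fins_A y : R := fins_b y + g * fins_q y / 2.
Definition fins_B y : R :=
  fins_b y ^+ 2 + g * fins_b y * fins_q y + fins_q y ^+ 2.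
Definition fins_f y : R := acos (fins_A y / Num.sqrt (fins_B y)).
Definition fins_chi y : R := fins_f y / fins_h.
Definition fins_K y : R :=
  Num.sqrt (fins_B y) * expR (- (g * fins_chi y / 2)).

(* K^2 is C^2 off the origin, so that on the axis y = +-b these second
   derivatives are the continuous extension of their values off the axis. *)
Definition fins_metric y : 'M[R]_n := \matrix_(i, j)
  ('D_(delta_mx 0 i) (fun z => 'D_(delta_mx 0 j) (fun w => fins_K w ^+ 2) z) y
     / 2).

Definition fins_indicatrix : set 'rV[R]_n := [set y | fins_K y = 1].

End Finsleroid.

(* Radius [r] sphere of the Euclidean space R^n, of dimension n - 1. *)
Definition euclidean_sphere (R : realType) (n : nat) (r : R) : set 'rV[R]_n :=
  [set z | Num.sqrt (\sum_i z 0 i ^+ 2) = r].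

Definition euclidean_metric (R : realType) (n : nat) (z : 'rV[R]_n) : 'M[R]_n :=
  1%:M.

(* [f] is C^1 on an arbitrary subset: near each point of [S] it is the
   restriction of a C^1 map defined on an open set. *)
Definition C1_on (R : realType) (m n : nat) (S : set 'rV[R]_m)
    (f : 'rV[R]_m -> 'rV[R]_n) : Prop :=
  forall p, S p -> exists (U : set 'rV[R]_m) (F : 'rV[R]_m -> 'rV[R]_n),
    [/\ open U, U p, class_C 1 U F & forall z, S z -> U z -> F z = f z].

(* Differentiable curves of [S] through [p]; for a submanifold [S] their
   velocities at 0 are exactly the tangent vectors of [S] at [p]. *)
Definition curve_in (R : realType) (n : nat) (S : set 'rV[R]_n) (p : 'rV[R]_n)
    (c : R -> 'rV[R]_n) : Prop :=
  [/\ c 0 = p, forall t, S (c t) & derivable c 0 1].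

(* [S1] and [S2] are submanifolds of R^m and R^n carrying the Riemannian metrics
   induced by the fields of bilinear forms [G1] and [G2]. An isometry is a
   diffeomorphism [phi] preserving the inner product of tangent vectors, the
   differential of [phi] being the map c'(0) |-> (phi o c)'(0). The class is C^1
   because a level set of a C^2 function is only a C^2 submanifold with a
   continuous induced metric. *)
Definition globally_isometric (R : realType) (m n : nat)
    (S1 : set 'rV[R]_m) (G1 : 'rV[R]_m -> 'M[R]_m)
    (S2 : set 'rV[R]_n) (G2 : 'rV[R]_n -> 'M[R]_n) : Prop :=
  exists (phi : 'rV[R]_m -> 'rV[R]_n) (psi : 'rV[R]_n -> 'rV[R]_m),
    [/\ (forall p, S1 p -> S2 (phi p) /\ psi (phi p) = p),
        (forall z, S2 z -> S1 (psi z) /\ phi (psi z) = z),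
        C1_on S1 phi,
        C1_on S2 psi
      & forall p c1 c2, S1 p -> curve_in S1 p c1 -> curve_in S1 p c2 ->
          bilin (G2 (phi p)) (derive1 (phi \o c1) 0) (derive1 (phi \o c2) 0)
          = bilin (G1 p) (derive1 c1 0) (derive1 c2 0)].

(* Main.v *)
From HB Require Import structures.
Require Import Defs.
From mathcomp Require Import all_boot all_order all_algebra.
From mathcomp Require Import all_classical all_reals all_analysis.
From mathcomp Require Import ring lra.
Import Order.TTheory GRing.Theory Num.Theory.
Import numFieldNormedType.Exports.
Local Open Scope classical_set_scope.
Local Open Scope ring_scope.

(** At a fixed point, a linear change of coordinates ([cholesky]) turns
    the metric into the dot product and [b] into a unit vector [e]. A
    vector [u] then has an axial component b, a transverse part w, and q =
    |w|. Put A = b + g q / 2. The pair (A, h q) has squared length B and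
    polar angle f, so that K^2 = B exp (- g f / h).

    The isometry keeps the direction of w and sends the angle f to the
    angle from the axis on the sphere of radius 1 / h: a vector of the
    indicatrix goes to (A e + h w) / (h sqrt B), which is exp (- g f / (2
    h)) ((b + g q / 2) e / h + w) because B = exp (g f / h) there
    ([sphere_map]). In the plane (A, h q) the Hessian of half of K^2
    restricts to df^2 / h^2 on the curve K = 1, and rotating w contributes
    (sin f / h)^2 times the metric of the unit sphere of directions w /
    |w|: together this is the round metric of radius 1 / h. The
    computation is done in Cartesian form in [dot_dsphere], comparing the
    differential of the gradient of half of K^2 with that of the isometry.

    The analytic difficulty is the axis w = 0, where neither q nor f is
    differentiable. The gradient of half of K^2, the isometry and its
    inverse are all of the form exp (k f) ((al b + be q) e + w), with f
    the angle of (b + nu q, ta q). Near the axis f is 0 or pi up to the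
    arc tangent of ta q / (b + nu q), and the terms of first order in q
    cancel exactly when k ta al + be = 0. This relation holds in the three
    cases and makes such a map continuously differentiable on all nonzero
    vectors ([is_diff_conic_map], [continuous_dconic]). In particular K^2
    is of class C^2 there, and its second derivatives on the axis are
    given by the same formula. *)

Set Implicit Arguments.
Unset Strict Implicit.
Unset Printing Implicit Defensive.

(** * Differential calculus at a point *)

Section Calculus.
Context {R : realType}.

Lemma continuous_near (T U : topologicalType) (f g : T -> U) (x : T) :
  (\forall y \near x, f y = g y) -> {for x, continuous f} ->
  {for x, continuous g}.
Proof.
move=> fg cf; rewrite /prop_for /continuous_at -(nbhs_singleton fg).
exact: cvg_trans (near_eq_cvg fg) cf.
Qed.

Lemma cont_comp (T U Z : topologicalType) (g : U -> Z) (f : T -> U) x :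
  {for x, continuous f} -> {for f x, continuous g} ->
  {for x, continuous (fun y => g (f y))}.
Proof. by move=> cf cg; exact: continuous_comp. Qed.

Section ContinuityAt.
Context {T : topologicalType} {W : normedModType R}.
Implicit Types x : T.

Lemma cont_add (f g : T -> W) x : {for x, continuous f} ->
  {for x, continuous g} -> {for x, continuous (fun y => f y + g y)}.
Proof. by move=> cf cg; exact: cvgD. Qed.

Lemma cont_opp (f : T -> W) x : {for x, continuous f} ->
  {for x, continuous (fun y => - f y)}.
Proof. by move=> cf; exact: cvgN. Qed.

Lemma cont_sum (I : Type) (s : seq I) (f : I -> T -> W) x :
  (forall i, {for x, continuous (f i)}) ->
  {for x, continuous (fun y => \sum_(i <- s) f i y)}.
Proof.
move=> cf; elim: s => [|i s ih].
  have -> : (fun y => \sum_(i <- [::]) f i y) = fun=> 0.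
    by apply/funext => y; rewrite big_nil.
  exact: cvg_cst.
have -> : (fun y => \sum_(j <- i :: s) f j y) =
          (fun y => f i y + \sum_(j <- s) f j y).
  by apply/funext => y; rewrite big_cons.
exact: cont_add.
Qed.

Lemma cont_scale (k : T -> R) (f : T -> W) x : {for x, continuous k} ->
  {for x, continuous f} -> {for x, continuous (fun y => k y *: f y)}.
Proof. by move=> ck cf; exact: cvgZ. Qed.

Lemma cont_mul (f g : T -> R) x : {for x, continuous f} ->
  {for x, continuous g} -> {for x, continuous (fun y => f y * g y)}.
Proof. by move=> cf cg; exact: cvgM. Qed.

Lemma cont_inv (f : T -> R) x : f x != 0 -> {for x, continuous f} ->
  {for x, continuous (fun y => (f y)^-1)}.
Proof. by move=> f0 cf; exact: cvgV. Qed.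

Lemma cont_cst (c : W) x : {for x, continuous (fun=> c)}.
Proof. exact: cvg_cst. Qed.

Lemma cont_mul_bounded (C : R) (f g : T -> R) x : {for x, continuous g} ->
  g x = 0 -> (forall y, `|f y| <= C) ->
  {for x, continuous (fun y => f y * g y)}.
Proof.
move=> cg g0 fC; rewrite /prop_for /continuous_at g0 mulr0.
have C1 : 0 < `|C| + 1 by rewrite ltr_wpDl.
apply/cvgrPdist_le => eps eps0.
have := cg => /cvgrPdist_le/(_ _ (divr_gt0 eps0 C1)).
rewrite g0; apply: filterS => y; rewrite !sub0r !normrN normrM => gy.
apply: le_trans (ler_pM (normr_ge0 _) (normr_ge0 _) (fC y) gy) _.
rewrite mulrC mulrAC ler_pdivrMr// ler_pM2l//.
by rewrite (le_trans (ler_norm C))// lerDl ler01.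
Qed.

End ContinuityAt.

Section General.
Context {V W : normedModType R}.

Lemma is_diff_expansion (f df : V -> W) (x : V) :
  linear df -> continuous df ->
  (forall eps, 0 < eps -> \forall y \near x,
     `|f y - f x - df (y - x)| <= eps * `|y - x|) ->
  is_diff x f df.
Proof.
move=> lin cdf H.
pose M := GRing.isLinear.Build _ _ _ _ _ lin.
pose L : {linear _ -> _} := HB.pack df M.
rewrite -[df]/(L : _ -> _) in cdf H *.
have E : f \o shift x = cst (f x) + L +o_ 0 id.
  apply/eqaddoP => eps eps0.
  have := H _ eps0; rewrite (near_shift 0) => Hn.
  apply: filterS Hn => h /=.
  by rewrite subr0 addrK -addrA -opprD.
have D : 'd f x = L :> (V -> W) by exact: diff_unique.
by apply: DiffDef => //; apply/diff_locallyP; rewrite D.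
Qed.

Lemma is_diff_expand (f df : V -> W) (x : V) : is_diff x f df ->
  forall eps, 0 < eps -> \forall y \near x,
     `|f y - f x - df (y - x)| <= eps * `|y - x|.
Proof.
move=> [/diff_locallyP[_ /eqaddoP H] E] eps eps0.
have := H _ eps0; rewrite E => Hn.
rewrite (near_shift 0); apply: filterS Hn => h /=.
by rewrite subr0 addrK -addrA -opprD.
Qed.

Lemma is_diff_near (f g df : V -> W) (x : V) :
  (\forall y \near x, f y = g y) -> is_diff x f df -> is_diff x g df.
Proof.
move=> fg dfx; have [cdf E] := dfx; rewrite -E.
apply: is_diff_expansion => [||eps eps0]; first exact: linearP.
  exact: diff_continuous.
have := is_diff_expand dfx eps0; rewrite E.
by rewrite -(nbhs_singleton fg); apply: filterS2 fg => y ->.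
Qed.

Lemma is_diff_derive (f df : V -> W) (x v : V) : is_diff x f df ->
  derivable f x v /\ 'D_v f x = df v.
Proof.
move=> [dfx E]; split; first exact: diff_derivable.
by rewrite deriveE// E.
Qed.

End General.

(** Caratheodory's form of the derivative. *)
Lemma is_derive_remainder (g : R -> R) (d : R) :
  is_derive (0 : R) (1 : R) g d ->
  exists r : R -> R, [/\ {for 0, continuous r}, r 0 = 0 &
    forall s, g s = g 0 + s * (d + r s)].
Proof.
move=> dg; have dg' : is_diff (0 : R) g (fun s => s *: d).
  have /derivable1_diffP ? : derivable g (0 : R) (1 : R) by apply: ex_derive.
  by apply: DiffDef => //; rewrite diff1E//; apply/funext => t;
    rewrite derive1E derive_val.
pose r s := if s == 0 then 0 else (g s - g 0) / s - d.
exists r; split; [|by rewrite /r eqxx|move=> s]; last first.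
  rewrite /r; have [->|s0] := eqVneq s 0; first by rewrite mul0r addr0.
  by field.
rewrite /prop_for /continuous_at {2}/r eqxx; apply/cvgrPdist_le => eps eps0.
have := is_diff_expand dg' eps0; apply: filterS => s /=.
rewrite !subr0 sub0r normrN.
rewrite /r; have [->|s0] := eqVneq s 0; first by rewrite normr0 (ltW eps0).
have -> : g s - g 0 - s *: d = ((g s - g 0) / s - d) * s.
  by rewrite mulrBl divfK// [d * s]mulrC.
by rewrite normrM ler_pM2r// normr_gt0.
Qed.

Section Rules.
Context {V W : normedModType R}.

(** A Lipschitz factor vanishing at [x] times a factor tending to 0 is of second
    order, although the Lipschitz factor (a norm, for instance) need not be
    differentiable. *)
Lemma is_diff_mul_small (q rho : V -> R) (C : R) (x : V) :
  (forall y, `|q y| <= C * `|y - x|) -> {for x, continuous rho} -> rho x = 0 ->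
  is_diff x (fun y => q y * rho y) (cst 0).
Proof.
move=> qC crho rho0.
have qx : q x = 0.
  by apply/eqP; rewrite -normr_le0 (le_trans (qC x))// subrr normr0 mulr0.
apply: is_diff_expansion => [k u v||eps eps0].
- by rewrite /= scaler0 addr0.
- exact: cst_continuous.
have C1 : 0 < `|C| + 1 by rewrite ltr_wpDl.
have := crho => /cvgrPdist_le /(_ _ (divr_gt0 eps0 C1)).
rewrite rho0; apply: filterS => y; rewrite sub0r normrN => rhoy.
rewrite /= qx mul0r !subr0 normrM.
apply: le_trans (ler_pM (normr_ge0 _) (normr_ge0 _) (qC y) rhoy) _.
rewrite mulrAC ler_wpM2r// mulrC mulrAC ler_pdivrMr// ler_pM2l//.
by rewrite (le_trans (ler_norm C))// lerDl ler01.
Qed.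

Lemma is_diff_sum (I : Type) (s : seq I) (f df : I -> V -> W) (x : V) :
  (forall i, is_diff x (f i) (df i)) ->
  is_diff x (fun y => \sum_(i <- s) f i y) (fun v => \sum_(i <- s) df i v).
Proof.
move=> dfx; elim: s => [|i s ih].
  under eq_fun do rewrite big_nil; apply: is_diff_eq.
  by apply/funext => v; rewrite big_nil.
under eq_fun do rewrite big_cons; apply: is_diff_eq.
by apply/funext => v; rewrite big_cons.
Qed.

Lemma is_diffMf (f g df dg : V -> R) (x : V) :
  is_diff x f df -> is_diff x g dg ->
  is_diff x (fun y => f y * g y) (fun v => f x * dg v + df v * g x).
Proof.
move=> dfx dgx; apply: is_diff_eq (is_diffM dfx dgx) _.
by apply/funext => v /=; rewrite [df v * _]mulrC.
Qed.

Lemma is_diff_comp1 (f df : V -> R) (g : R -> W) (dg : W) (x : V) :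
  is_diff x f df -> is_derive (f x) 1 g dg ->
  is_diff x (fun y => g (f y)) (fun v => df v *: dg).
Proof.
move=> dfx dgx.
have dg' : is_diff (f x) g (fun t => t *: dg).
  have /derivable1_diffP ? : derivable g (f x) 1 by apply: ex_derive.
  apply: DiffDef => //; rewrite diff1E//; apply/funext => t.
  by rewrite derive1E derive_val.
exact: is_diff_comp dfx dg'.
Qed.

Lemma is_diffZr (k dk : V -> R) (w : W) (x : V) : is_diff x k dk ->
  is_diff x (fun y => k y *: w) (fun v => dk v *: w).
Proof.
move=> dkx; have [? E] := dkx.
by apply: DiffDef; [exact: differentiableZl|rewrite diffZl// E].
Qed.

Lemma is_diffVf (f df : V -> R) (x : V) : is_diff x f df -> f x != 0 ->
  is_diff x (fun y => (f y)^-1) (fun v => - f x ^- 2 * df v).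
Proof.
move=> dfx fx0; have [? E] := dfx.
by apply: DiffDef; [exact: differentiableV|rewrite diffV// E].
Qed.

Lemma is_diffZf (c : R) (f df : V -> W) (x : V) : is_diff x f df ->
  is_diff x (fun y => c *: f y) (fun v => c *: df v).
Proof. by move=> dfx; exact: is_diffZ. Qed.

Lemma is_diffNf (f df : V -> W) (x : V) : is_diff x f df ->
  is_diff x (fun y => - f y) (fun v => - df v).
Proof. by move=> dfx; exact: is_diffN. Qed.

Lemma is_diff_cstf (c : W) (x : V) : is_diff x (fun=> c) (fun=> 0).
Proof. exact: is_diff_cst. Qed.

Lemma is_diffDf (f g df dg : V -> W) (x : V) :
  is_diff x f df -> is_diff x g dg ->
  is_diff x (fun y => f y + g y) (fun v => df v + dg v).
Proof. by move=> dfx dgx; exact: is_diffD. Qed.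

(** The chain rule along a curve that is only known to be differentiable at the
    parameter considered. *)
Lemma derive1_comp_curve (f df : V -> W) (c : R -> V) (t : R) (x : V) :
  c t = x -> is_diff x f df -> derivable c t 1 ->
  derive1 (f \o c) t = df (derive1 c t).
Proof.
move=> <- dfc dc.
have dcd : is_diff t c ( *:%R ^~ (derive1 c t)).
  by apply: DiffDef; [apply/derivable1_diffP|rewrite deriv1E].
have dfcd : is_diff t (f \o c) (df \o *:%R ^~ (derive1 c t)).
  exact: is_diff_comp.
have [_ E] := is_diff_derive (1 : R) dfcd.
by rewrite derive1E E /= scale1r.
Qed.

End Rules.

Section RowVectors.
Context {n : nat} {V W : normedModType R}.

Lemma row_decomp (u : 'rV[R]_n) : u = \sum_i u 0 i *: delta_mx 0 i.
Proof. by rewrite {1}[u]row_sum_delta. Qed.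

Lemma is_diff_coord (i : 'I_n) (x : 'rV[R]_n) :
  is_diff x (fun u : 'rV[R]_n => u 0 i) (fun u => u 0 i).
Proof.
have lin : linear (fun u : 'rV[R]_n => u 0 i) by move=> k u v; rewrite !mxE.
apply: is_diff_expansion => // [|eps eps0]; first exact: coord_continuous.
by near=> y; rewrite /= !mxE subrr normr0 mulr_ge0// ltW.
Unshelve. all: by end_near. Qed.

Lemma is_diff_linear (f : 'rV[R]_n -> W) (x : 'rV[R]_n) : linear f ->
  is_diff x f f.
Proof.
move=> lin.
pose M := GRing.isLinear.Build _ _ _ _ _ lin.
pose L : {linear _ -> _} := HB.pack f M.
have E : f = fun u => \sum_i u 0 i *: f (delta_mx 0 i).
  apply/funext => u; rewrite {1}(row_decomp u) -[f]/(L : _ -> _) linear_sum.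
  by under eq_bigr do rewrite linearZ.
rewrite {1 2}E; apply: is_diff_sum => i; apply: is_diffZr.
exact: is_diff_coord.
Qed.

Lemma linear_continuous_row (f : 'rV[R]_n -> W) x : linear f ->
  {for x, continuous f}.
Proof.
by move=> lin; apply: differentiable_continuous; case: (is_diff_linear x lin).
Qed.

Lemma is_diff_row (f df : V -> 'rV[R]_n) (x : V) :
  (forall j, is_diff x (fun y => f y 0 j) (fun v => df v 0 j)) ->
  is_diff x f df.
Proof.
move=> H; have -> : f = fun y => \sum_j f y 0 j *: delta_mx 0 j.
  by apply/funext => y; rewrite -row_decomp.
have -> : df = fun y => \sum_j df y 0 j *: delta_mx 0 j.
  by apply/funext => y; rewrite -row_decomp.
by apply: is_diff_sum => j; apply: is_diffZr.
Qed.

Lemma continuous_row {T : topologicalType} (f : T -> 'rV[R]_n) (x : T) :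
  (forall j, {for x, continuous (fun y => f y 0 j)}) -> {for x, continuous f}.
Proof.
move=> H; have -> : f = fun y => \sum_j f y 0 j *: delta_mx 0 j.
  by apply/funext => y; rewrite -row_decomp.
by apply: cont_sum => j; apply: cont_scale => //; exact: cont_cst.
Qed.

(** Frechet differentials that depend continuously on the point give the
    continuous partial derivatives of [class_C]. *)
Lemma class_C1_is_diff (U : set 'rV[R]_n) (f : 'rV[R]_n -> W)
    (df : 'rV[R]_n -> 'rV[R]_n -> W) :
  (forall p, U p -> is_diff p f (df p)) ->
  open U ->
  (forall v p, U p -> {for p, continuous (fun p => df p v)}) ->
  class_C 1 U f.
Proof.
move=> dfU oU cdf; split=> [p Up|i].
  by apply: differentiable_continuous; case: (dfU _ Up).
split=> [p Up|]; first by have [] := is_diff_derive (delta_mx 0 i) (dfU _ Up).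
split=> // p Up.
apply: (@continuous_near _ _ (fun q => df q (delta_mx 0 i))); last exact: cdf.
have /filterS := oU _ Up; apply => q Uq.
by have [_ ->] := is_diff_derive (delta_mx 0 i) (dfU _ Uq).
Qed.

End RowVectors.
End Calculus.

(** * Euclidean geometry of row vectors *)

Section Dot.
Context {R : realType} {n : nat}.
Implicit Types u v w e : 'rV[R]_n.

Definition dot u v : R := \sum_i u 0 i * v 0 i.

Lemma dotC u v : dot u v = dot v u.
Proof. by apply: eq_bigr => i _; rewrite mulrC. Qed.

Lemma dotDl u v w : dot (u + v) w = dot u w + dot v w.
Proof. by rewrite -big_split; apply: eq_bigr => i _; rewrite mxE mulrDl. Qed.

Lemma dotZl k u v : dot (k *: u) v = k * dot u v.
Proof. by rewrite mulr_sumr; apply: eq_bigr => i _; rewrite mxE mulrA. Qed.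

Lemma dotDr u v w : dot w (u + v) = dot w u + dot w v.
Proof. by rewrite dotC dotDl !(dotC w). Qed.

Lemma dotZr k u v : dot u (k *: v) = k * dot u v.
Proof. by rewrite dotC dotZl dotC. Qed.

Lemma dot0l v : dot 0 v = 0.
Proof. by rewrite /dot big1// => i _; rewrite mxE mul0r. Qed.

Lemma dot0r v : dot v 0 = 0.
Proof. by rewrite dotC dot0l. Qed.

Lemma dotNl u v : dot (- u) v = - dot u v.
Proof. by rewrite -scaleN1r dotZl mulN1r. Qed.

Lemma dotNr u v : dot u (- v) = - dot u v.
Proof. by rewrite dotC dotNl dotC. Qed.

Lemma dot_linear v : linear (dot ^~ v : 'rV[R]_n -> R).
Proof. by move=> k u w; rewrite dotDl dotZl. Qed.

Lemma dot_ge0 u : 0 <= dot u u.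
Proof. by apply: sumr_ge0 => i _; rewrite -expr2 sqr_ge0. Qed.

Lemma dot_eq0 u : (dot u u == 0) = (u == 0).
Proof.
apply/eqP/eqP => [u0|->]; last exact: dot0l.
apply/rowP => i; rewrite mxE; apply/eqP; rewrite -sqrf_eq0 expr2; apply/eqP.
by apply: (psumr_eq0P (P := xpredT) _ u0) => // j _; rewrite -expr2 sqr_ge0.
Qed.

Lemma cauchy_schwarz u v : dot u v ^+ 2 <= dot u u * dot v v.
Proof.
have [->|v0] := eqVneq v 0.
  by rewrite !dot0r expr0n mulr0.
have vv : 0 < dot v v by rewrite lt_neqAle eq_sym dot_eq0 v0 dot_ge0.
have := dot_ge0 (dot v v *: u - dot u v *: v).
rewrite !(dotDl, dotDr, dotNl, dotNr, dotZl, dotZr) (dotC v u).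
set a := dot u u; set b := dot v v; set c := dot u v => H.
have {H} : 0 <= b * (a * b - c ^+ 2).
  apply: le_trans H _; rewrite le_eqVlt; apply/orP; left; apply/eqP; ring.
by rewrite pmulr_rge0// subr_ge0.
Qed.

Lemma coord_le_norm u i : `|u 0 i| <= `|u|.
Proof.
rewrite [leRHS]mx_normrE.
exact: (le_bigmax _ (fun ij : 'I_1 * 'I_n => `|u ij.1 ij.2|) (0, i)).
Qed.

Lemma dot_le_norm u : dot u u <= n%:R * `|u| ^+ 2.
Proof.
apply: (@le_trans _ _ (\sum_(i < n) `|u| ^+ 2)).
  apply: ler_sum => i _; rewrite -expr2 -real_normK ?num_real//.
  by rewrite ler_sqr ?nnegrE// coord_le_norm.
by rewrite sumr_const card_ord mulr_natl.
Qed.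

(** Cylindrical coordinates around the axis of the unit vector [e]: the
    component along [e], the transverse part and its length. *)

Definition ax e u : R := dot u e.
Definition tr e u : 'rV[R]_n := u - ax e u *: e.
Definition rad e u : R := Num.sqrt (dot (tr e u) (tr e u)).

Section Axis.
Variable e : 'rV[R]_n.
Hypothesis e1 : dot e e = 1.

Lemma ax_linear : linear (ax e : 'rV[R]_n -> R).
Proof. exact: dot_linear. Qed.

Lemma tr_linear : linear (tr e).
Proof.
move=> k u v; rewrite /tr ax_linear scalerDl -[_ *: ax e u]/(_ * _) scalerBr.
by rewrite scalerA opprD addrACA.
Qed.

Lemma ax_e u k v : ax e (k *: e + v) = k + ax e v.
Proof. by rewrite /ax dotDl dotZl e1 mulr1. Qed.

Lemma ax_tr u : ax e (tr e u) = 0.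
Proof. by rewrite /ax /tr dotDl dotNl dotZl e1 mulr1 subrr. Qed.

Lemma ax_trZ k s u : ax e (k *: e + s *: tr e u) = k.
Proof.
by rewrite {1}/ax dotDl !dotZl e1 -/(ax e _) ax_tr mulr0 addr0 mulr1.
Qed.

Lemma tr_trZ k s u : tr e (k *: e + s *: tr e u) = s *: tr e u.
Proof. by rewrite /tr ax_trZ addrC addKr. Qed.

Lemma tr_add u : ax e u *: e + tr e u = u.
Proof. by rewrite addrC subrK. Qed.

Lemma dot_tr u v : dot (tr e u) v = dot u v - ax e u * ax e v.
Proof. by rewrite /tr dotDl dotNl dotZl (dotC e). Qed.

Lemma dot_trl u v : dot (tr e u) (tr e v) = dot (tr e u) v.
Proof. by rewrite {2}/tr dotDr dotNr dotZr -/(ax e _) ax_tr mulr0 subr0. Qed.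

Lemma dot_split u v : dot u v = ax e u * ax e v + dot (tr e u) (tr e v).
Proof. by rewrite dot_trl dot_tr addrC subrK. Qed.

Lemma rad_ge0 u : 0 <= rad e u.
Proof. exact: sqrtr_ge0. Qed.

Lemma rad_sqr u : rad e u ^+ 2 = dot (tr e u) u.
Proof. by rewrite sqr_sqrtr ?dot_ge0// dot_trl. Qed.

Lemma rad_trZ k s u : 0 <= s -> rad e (k *: e + s *: tr e u) = s * rad e u.
Proof.
move=> s0; rewrite /rad tr_trZ dotZl dotZr mulrA sqrtrM -?expr2 ?sqr_ge0//.
by rewrite sqrtr_sqr ger0_norm.
Qed.

Lemma rad_eq0 u : (rad e u == 0) = (tr e u == 0).
Proof. by rewrite -dot_eq0 -sqrf_eq0 rad_sqr dot_trl. Qed.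

Lemma rad0_ax_neq0 u : u != 0 -> rad e u = 0 -> ax e u != 0.
Proof.
move=> u0 /eqP; rewrite rad_eq0 => /eqP ru; apply: contra u0 => /eqP au.
by rewrite -(tr_add u) ru au scale0r addr0.
Qed.

Lemma rad_gt0_neq0 u : 0 < rad e u -> u != 0.
Proof.
apply: contraTneq => ->; rewrite -leNgt le_eqVlt rad_eq0.
by rewrite /tr /ax dot0l scale0r subr0 eqxx.
Qed.

Lemma dot_le_rad u v : `|dot (tr e u) v| <= rad e u * Num.sqrt (dot v v).
Proof.
rewrite -sqrtr_sqr /rad -sqrtrM ?dot_ge0// ler_sqrt ?mulr_ge0 ?dot_ge0//.
exact: cauchy_schwarz.
Qed.

Lemma tr_coord_le_rad u i : `|tr e u 0 i| <= rad e u.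
Proof.
rewrite -sqrtr_sqr ler_sqrt ?dot_ge0// /dot (bigD1 i)//= -expr2 lerDl.
by apply: sumr_ge0 => j _; rewrite -expr2 sqr_ge0.
Qed.

(** On the axis the transverse part vanishes, so [rad e v] is the transverse
    length of [v - u]. *)
Lemma rad_le_dist u v : rad e u = 0 ->
  rad e v <= Num.sqrt n%:R * `|v - u|.
Proof.
move=> /eqP; rewrite rad_eq0 => /eqP ru.
have -> : rad e v = rad e (v - u).
  rewrite /rad; have -> : tr e (v - u) = tr e v; last by [].
  by rewrite -[v - u]addrC -scaleN1r tr_linear ru scaler0 add0r.
apply: (@le_trans _ _ (Num.sqrt (n%:R * `|v - u| ^+ 2))).
  rewrite ler_sqrt ?mulr_ge0//; apply: le_trans (dot_le_norm _).
  by rewrite dot_trl dot_tr gerBl -expr2 sqr_ge0.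
by rewrite sqrtrM// sqrtr_sqr normr_id.
Qed.

Lemma is_diff_dot_tr u :
  is_diff u (fun u => dot (tr e u) (tr e u)) (fun v => 2 * dot (tr e u) v).
Proof.
pose f u := \sum_i u 0 i * u 0 i - ax e u * ax e u : R.
have -> : (fun u => dot (tr e u) (tr e u)) = f.
  by apply/funext => v; rewrite dot_trl dot_tr.
have df : is_diff u f (fun v => \sum_i (u 0 i * v 0 i + v 0 i * u 0 i)
    + - (ax e u * ax e v + ax e v * ax e u)).
  apply: is_diffDf; first apply: is_diff_sum => i.
    by apply: is_diffMf; exact: is_diff_coord.
  apply: is_diffN; apply: is_diffMf; apply: is_diff_linear; exact: ax_linear.
apply: is_diff_eq df _; apply/funext => v.
rewrite big_split/= -![\sum_(i < n) _]/(dot _ _) (dotC v u) dot_tr; ring.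
Qed.

Lemma continuous_rad u : {for u, continuous (rad e)}.
Proof.
apply: (@cont_comp _ _ _ _ (fun u => dot (tr e u) (tr e u))).
  by apply: differentiable_continuous; case: (is_diff_dot_tr u).
exact: sqrt_continuous.
Qed.

Lemma is_diff_rad u : 0 < rad e u ->
  is_diff u (rad e) (fun v => dot (tr e u) v / rad e u).
Proof.
move=> r0; have := r0; rewrite sqrtr_gt0 => f0.
apply: is_diff_eq (is_diff_comp1 (is_diff_dot_tr u) (is_derive1_sqrt f0)) _.
apply/funext => v; rewrite -/(rad e u) /GRing.scale/=.
by have := gt_eqF r0; set r := rad e u => r1; field; rewrite r1.
Qed.

End Axis.
End Dot.

(** * Polar angle in the upper half plane *)

Section PolarAngle.
Context {R : realType}.
Implicit Types x y c : R.

Definition arg x y : R := acos (x / Num.sqrt (x ^+ 2 + y ^+ 2)).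

Lemma arg_homog c x y : 0 < c -> arg (c * x) (c * y) = arg x y.
Proof.
move=> c0; rewrite /arg !exprMn -mulrDr sqrtrM ?sqr_ge0// sqrtr_sqr gtr0_norm//.
by rewrite -mulf_div divff ?gt_eqF// mul1r.
Qed.

Let pi2_lt : pi / 2 < (pi : R).
Proof. by rewrite ltr_pdivrMr// ltr_pMr ?pi_gt0// ltr1n. Qed.

Let arg_cos x y t : 0 <= t <= pi -> x / Num.sqrt (x ^+ 2 + y ^+ 2) = cos t ->
  arg x y = t.
Proof. by move=> t0 E; rewrite /arg E cosK// in_itv. Qed.

Let sqrt_factor x y : 0 < x ->
  Num.sqrt (x ^+ 2 + y ^+ 2) = x * Num.sqrt (1 + (y / x) ^+ 2).
Proof.
move=> x0; rewrite -{2}(gtr0_norm x0) -sqrtr_sqr -sqrtrM ?sqr_ge0//.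
by congr Num.sqrt; field; rewrite gt_eqF.
Qed.

(** The branches [arg_gt0], [arg_lt0] and [arg_up] write the angle with arctan,
    which is differentiable everywhere, whereas arccos is singular at the end
    points, that is, on the axis [y = 0]. *)
Lemma arg_gt0 x y : 0 < x -> 0 <= y -> arg x y = atan (y / x).
Proof.
move=> x0 y0; apply: arg_cos.
  rewrite -atan0 le_atan ?divr_ge0 ?(ltW x0)//=.
  by rewrite ltW// (lt_trans (atan_ltpi2 _)).
by rewrite cos_atan sqrt_factor// invfM mulrA divff ?gt_eqF// mul1r.
Qed.

Lemma arg_opp x y : arg (- x) y = pi - arg x y.
Proof.
rewrite /arg sqrrN mulNr acosN//.
have [->|d0] := eqVneq (Num.sqrt (x ^+ 2 + y ^+ 2)) 0.
  by rewrite invr0 mulr0 lerN10 ler01.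
rewrite -ler_norml normrM normfV [X in _ / X]ger0_norm ?sqrtr_ge0//.
have {}d0 : 0 < Num.sqrt (x ^+ 2 + y ^+ 2).
  by rewrite lt_neqAle eq_sym d0 sqrtr_ge0.
rewrite ler_pdivrMr// mul1r.
by rewrite -sqrtr_sqr ler_sqrt ?lerDl ?sqr_ge0// addr_ge0 ?sqr_ge0.
Qed.

Lemma arg_lt0 x y : x < 0 -> 0 <= y -> arg x y = pi + atan (y / x).
Proof.
move=> x0 y0; rewrite -[x in LHS]opprK arg_opp arg_gt0 ?oppr_gt0//.
by rewrite invrN mulrN atanN opprK.
Qed.

Lemma arg_up x y : 0 < y -> arg x y = pi / 2 - atan (x / y).
Proof.
move=> y0; have := atan_gtNpi2 (x / y); have := atan_ltpi2 (x / y).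
set t := atan _ => t1 t2; apply: arg_cos.
  by rewrite subr_ge0 (ltW t1)/=; move: t2; lra.
rewrite cosB cos_pihalf sin_pihalf mul0r add0r mul1r.
have <- : tan t * cos t = sin t.
  by rewrite /tan divfK// gt_eqF// cos_gt0_pihalf// t1 t2.
by rewrite atanK cos_atan addrC sqrt_factor// invfM mulrA.
Qed.

End PolarAngle.

(** * A family of homogeneous maps singular on the axis *)

Section ConicMap.
Context {R : realType} {n : nat}.
Variable e : 'rV[R]_n.
Hypothesis e1 : dot e e = 1.
Variables k al be nu ta : R.
Implicit Types u v w : 'rV[R]_n.

(** With [nu = g / 2] and [ta = h] these are the functions A, B and f of the
    Finsleroid; [nu = 0] and [ta = 1] give the ordinary polar angle. *)
Definition skew_ax u : R := ax e u + nu * rad e u.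
Definition skew_form u : R := skew_ax u ^+ 2 + (ta * rad e u) ^+ 2.
Definition skew_angle u : R := arg (skew_ax u) (ta * rad e u).
Definition weight u : R := expR (k * skew_angle u).
(** The gradient of half of K^2, the map of the indicatrix onto the sphere and
    the inverse of that map are all of this form, for different constants. *)
Definition conic_map u : 'rV[R]_n :=
  weight u *: ((al * ax e u + be * rad e u) *: e + tr e u).

(** [drad] and [dangle] are the differentials of [rad] and [skew_angle] off the
    axis.  On the axis [drad] is 0 by the convention on division, and [dconic]
    is still the differential of [conic_map] when [k * ta * al + be = 0]. *)
Definition drad u v : R := dot (tr e u) v / rad e u.
Definition dangle u v : R :=
  ta * (ax e u * drad u v - rad e u * ax e v) / skew_form u.
(** Up to the factor [weight u], the coefficient of the non-smooth [drad] in the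
    axial component is
    [be + k * ta * ax e u * (al * ax e u + be * rad e u) / skew_form u].  When
    [k * ta * al + be = 0] it is divisible by [rad e u], and
    [rad e u * drad u v = dot (tr e u) v] is linear; the formula is written
    after this cancellation, hence has no singularity on the axis. *)
Definition dconic_ax u v : R :=
  weight u * (al * ax e v
    + be * ((2 * nu + k * ta) * ax e u + (nu ^+ 2 + ta ^+ 2) * rad e u)
        / skew_form u * dot (tr e u) v
    - k * ta * rad e u * ax e v / skew_form u * (al * ax e u + be * rad e u)).
Definition dconic u v : 'rV[R]_n :=
  dconic_ax u v *: e
  + weight u *: (tr e v + (k * dangle u v) *: tr e u).

Hypothesis ta0 : 0 < ta.

Lemma skew_form_gt0 u : u != 0 -> 0 < skew_form u.
Proof.
move=> u0; rewrite /skew_form /skew_ax lt_neqAle addr_ge0 ?sqr_ge0// andbT.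
rewrite eq_sym paddr_eq0 ?sqr_ge0// !sqrf_eq0 mulf_eq0 (gt_eqF ta0)/=.
apply/negP => /andP[/eqP a0 /eqP r0]; move: a0; rewrite r0 mulr0 addr0.
by move/eqP; apply/negP; exact: (rad0_ax_neq0 e1 u0 r0).
Qed.

Lemma continuous_ax u : {for u, continuous (ax e : 'rV[R]_n -> R)}.
Proof. by apply: linear_continuous_row; exact: ax_linear. Qed.

Lemma continuous_skew_ax u : {for u, continuous skew_ax}.
Proof.
apply: cont_add; first exact: continuous_ax.
by apply: cont_mul; [exact: cont_cst|exact: continuous_rad].
Qed.

Lemma continuous_skew_form u : {for u, continuous skew_form}.
Proof.
apply: cont_add.
  by apply: (@cont_mul _ _ skew_ax skew_ax); exact: continuous_skew_ax.
pose f v := ta * rad e v : R.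
have cf : {for u, continuous f}.
  by apply: cont_mul; [exact: cont_cst|exact: continuous_rad].
exact: (@cont_mul _ _ f f).
Qed.

(** Near a point of the axis the angle is, up to a constant, the arc tangent of
    a continuous slope; this is what replaces differentiability of arccos at
    the end points. *)
Lemma skew_angle_axis u : u != 0 -> rad e u = 0 ->
  exists t, \forall v \near u,
    skew_ax v != 0 /\ skew_angle v = t + atan (ta * rad e v / skew_ax v).
Proof.
move=> u0 r0; have a0 := rad0_ax_neq0 e1 u0 r0.
have E : skew_ax u = ax e u by rewrite /skew_ax r0 mulr0 addr0.
have tr0 v : 0 <= ta * rad e v by rewrite mulr_ge0 ?rad_ge0// ltW.
have [a_gt0|a_le0] := ltP 0 (ax e u).
  exists 0; have := @continuous_skew_ax u => /cvgr_gt/(_ 0).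
  rewrite E => /(_ a_gt0); apply: filterS => v v0.
  by rewrite gt_eqF// add0r; split=> //; exact: arg_gt0.
have a_lt0 : ax e u < 0 by rewrite lt_neqAle a0.
exists pi; have := @continuous_skew_ax u => /cvgr_lt/(_ 0).
rewrite E => /(_ a_lt0); apply: filterS => v v0.
by rewrite lt_eqF//; split=> //; exact: arg_lt0.
Qed.

Lemma near_rad_gt0 u : 0 < rad e u -> \forall v \near u, 0 < rad e v.
Proof. by have := @continuous_rad _ _ e e1 u => /cvgr_gt/(_ 0). Qed.

Lemma is_diff_skew_angle u : 0 < rad e u ->
  is_diff u skew_angle (dangle u).
Proof.
move=> r0.
have dr := is_diff_rad e1 r0.
have da : is_diff u (ax e) (ax e) := is_diff_linear u (ax_linear e).
have dskew : is_diff u skew_ax (fun v => ax e v + nu * drad u v).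
  exact: (is_diffDf da (is_diffZf nu dr)).
have nz : ta * rad e u != 0 by rewrite gt_eqF// mulr_gt0.
pose slope v := skew_ax v / (ta * rad e v).
apply: (@is_diff_near _ _ _ (fun v => pi / 2 - atan (slope v))).
  apply: filterS (near_rad_gt0 r0) => v v0.
  by rewrite -arg_up// mulr_gt0.
have dslope : is_diff u slope (fun v => skew_ax u *
   (- (ta * rad e u) ^- 2 * (ta * drad u v)) +
   (ax e v + nu * drad u v) * (ta * rad e u)^-1).
  exact: (is_diffMf dskew (is_diffVf (is_diffZf ta dr) nz)).
apply: is_diff_eq (is_diffDf (is_diff_cstf _ u)
  (is_diffNf (is_diff_comp1 dslope (is_derive1_atan _)))) _.
have u0 := rad_gt0_neq0 e1 r0.
apply/funext => v; rewrite add0r /GRing.scale/=.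
have := skew_form_gt0 u0; rewrite /slope /dangle /skew_form.
set a := skew_ax u; set r := rad e u in r0 nz *; set d := drad u v => B0.
have Ea : a = ax e u + nu * r by [].
have rn : r != 0 by rewrite gt_eqF.
have -> : ax e u = a - nu * r by rewrite Ea addrK.
field; rewrite gt_eqF//= rn gt_eqF//.
Qed.

End ConicMap.

(** * Continuous differentiability across the axis *)

(** Syntax-directed continuity; composite subterms must be hypotheses. *)
Ltac prove_continuous := lazymatch goal with
  | |- context [continuous (fun=> ?c)] => exact: cont_cst
  | |- context [continuous (fun w => @?f w + @?g w)] =>
      apply: (@cont_add _ _ _ f g); prove_continuous
  | |- context [continuous (fun w => - @?f w)] =>
      apply: (@cont_opp _ _ _ f); prove_continuous
  | |- context [continuous (fun w => @?f w * @?g w)] =>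
      first [assumption | apply: (@cont_mul _ _ f g); prove_continuous]
  | |- _ => assumption
  end.

Section ConicMapC1.
Context {R : realType} {n : nat}.
Variable e : 'rV[R]_n.
Hypothesis e1 : dot e e = 1.
Variables k al be nu ta : R.
Implicit Types u v w : 'rV[R]_n.
Hypothesis ta0 : 0 < ta.
(* The terms of first order in the distance to the axis cancel. *)
Hypothesis kab : k * ta * al + be = 0.

Local Notation W := (weight e k nu ta).
Local Notation F := (conic_map e k al be nu ta).
Local Notation A := (skew_ax e nu).
Local Notation dF := (dconic e k al be nu ta).

Lemma is_diff_weight u : 0 < rad e u ->
  is_diff u W (fun v => k * dangle e nu ta u v * W u).
Proof.
move=> r0; have da := is_diff_skew_angle e1 nu ta0 r0.
exact: (is_diff_comp1 (is_diffZf k da) (is_derive_expR _)).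
Qed.

Lemma weight_axis u : u != 0 -> rad e u = 0 ->
  exists r : 'rV[R]_n -> R, [/\ {for u, continuous r}, r u = 0 &
    \forall v \near u, A v != 0 /\
      W v = W u * (1 + ta * rad e v / A v * (k + r v))].
Proof.
move=> u0 r0; have [t Ht] := skew_angle_axis e1 nu ta0 u0 r0.
pose g s := expR (k * atan s) : R.
have dg : is_derive (0 : R) 1 g k.
  have := is_diff_comp1 (is_diffZf k (is_diff_comp1 (is_diff_id (0 : R))
    (is_derive1_atan 0))) (is_derive_expR (k * atan (0 : R))).
  move=> /(is_diff_derive (1 : R))[? E]; apply: DeriveDef => //; rewrite E /=.
  by rewrite atan0 mulr0 expR0 expr0n addr0 invr1 /GRing.scale/= !mulr1.
have [r [cr r00 Hr]] := is_derive_remainder dg.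
pose s v := ta * rad e v / A v.
have su : s u = 0 by rewrite /s r0 mulr0 mul0r.
have [Au Eu] := nbhs_singleton Ht.
exists (r \o s); split; last 2 first.
- by rewrite /= su.
- apply: filterS Ht => v [Av Ev]; split => //.
  rewrite /weight Ev Eu r0 mulr0 mul0r atan0 addr0 mulrDr expRD.
  by congr (_ * _); rewrite -/(g _) Hr /g atan0 mulr0 expR0.
apply: (@cont_comp _ _ _ r s); last by rewrite su.
apply: cont_mul; last by apply: cont_inv => //; exact: continuous_skew_ax.
by apply: cont_mul; [exact: cont_cst|exact: continuous_rad].
Qed.

Lemma continuous_weight u : u != 0 -> {for u, continuous W}.
Proof.
move=> u0; have := rad_ge0 e u; rewrite le_eqVlt => /orP[/eqP/esym r0|r0].
  have [r [cr ru Hr]] := weight_axis u0 r0.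
  have [Au _] := nbhs_singleton Hr.
  apply: (@continuous_near _ _
    (fun v => W u * (1 + ta * rad e v / A v * (k + r v)))).
    by apply: filterS Hr => v [].
  apply: cont_mul; first exact: cont_cst.
  apply: cont_add; first exact: cont_cst.
  apply: cont_mul; last by apply: cont_add => //; exact: cont_cst.
  apply: cont_mul; last by apply: cont_inv => //; exact: continuous_skew_ax.
  by apply: cont_mul; [exact: cont_cst|exact: continuous_rad].
by apply: differentiable_continuous; case: (is_diff_weight r0).
Qed.

Lemma tr_coord_linear j : linear (fun u => tr e u 0 j).
Proof. by move=> c u v; rewrite tr_linear// !mxE. Qed.

Lemma conic_mapE u j :
  F u 0 j = W u * ((al * ax e u + be * rad e u) * e 0 j + tr e u 0 j).
Proof. by rewrite /conic_map !mxE. Qed.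

Lemma dconicE u v j : dF u v 0 j = dconic_ax e k al be nu ta u v * e 0 j +
  W u * (tr e v 0 j + k * dangle e nu ta u v * tr e u 0 j).
Proof. by rewrite /dconic !mxE. Qed.

(** Near a point [u] of the axis the weight is [W u * (1 + s * (k + o(1)))]
    with [s] the slope [ta * rad / A].  Substituting this in the axial component
    leaves a linear term plus [rad] times [rho], and [rho] tends to 0 because of
    [k * ta * al + be = 0]. *)
Lemma is_diff_conic_map_axis u : u != 0 -> rad e u = 0 -> is_diff u F (dF u).
Proof.
move=> u0 r0; have [r [cr ru Hr]] := weight_axis u0 r0.
have [Au _] := nbhs_singleton Hr.
have tu0 : tr e u = 0 by apply/eqP; rewrite -rad_eq0// r0.
have AuE : A u = ax e u by rewrite /skew_ax r0 mulr0 addr0.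
pose rho v := al * ax e v * W u * ta / A v * (k + r v) + be * W v.
have rho0 : rho u = 0.
  rewrite /rho ru AuE addr0; move: Au; rewrite AuE => Au.
  rewrite -[RHS](mul0r (W u)) -kab; field; exact: Au.
have crho : {for u, continuous rho}.
  apply: cont_add; last first.
    by apply: cont_mul; [exact: cont_cst|exact: continuous_weight].
  apply: cont_mul; last by apply: cont_add => //; exact: cont_cst.
  apply: cont_mul; last by apply: cont_inv => //; exact: continuous_skew_ax.
  apply: cont_mul; last exact: cont_cst.
  apply: cont_mul; last exact: cont_cst.
  by apply: cont_mul; [exact: cont_cst|exact: continuous_ax].
apply: is_diff_row => j.
pose C := Num.sqrt n%:R : R.
have D1 : is_diff u (fun v => rad e v * rho v) (cst 0).
  apply: (@is_diff_mul_small _ _ _ _ C) => // v.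
  by rewrite ger0_norm ?rad_ge0//; exact: rad_le_dist.
have D2 : is_diff u (fun v => tr e v 0 j * (W v - W u)) (cst 0).
  apply: (@is_diff_mul_small _ _ _ _ C) => [v||]; last by rewrite subrr.
    exact: le_trans (tr_coord_le_rad e v j) (rad_le_dist e1 v r0).
  by apply: cont_add; [exact: continuous_weight|exact: cont_cst].
have D3 := is_diffZf (W u * al * e 0 j) (is_diff_linear u (ax_linear e)).
have D4 := is_diffZf (W u) (is_diff_linear u (@tr_coord_linear j)).
apply: is_diff_near (is_diff_eq (is_diffDf (is_diffDf D3 D4)
   (is_diffDf (is_diffZf (e 0 j) D1) D2)) _).
  apply: filterS Hr => v [Av Wv]; rewrite conic_mapE /rho Wv.
  have H (w a q t ej c z : R) : z != 0 -> w * al * ej * a + w * t +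
    (ej * (q * (al * a * w * ta / z * c + be * (w * (1 + ta * q / z * c)))) +
     t * (w * (1 + ta * q / z * c) - w)) =
    w * (1 + ta * q / z * c) * ((al * a + be * q) * ej + t).
    by move=> z0; field.
  exact: H.
apply/funext => v; rewrite dconicE /dconic_ax tu0 r0.
rewrite (_ : (0 : 'rV[R]_n) 0 j = 0); last by rewrite mxE.
rewrite /GRing.scale/=.
rewrite dot0l.
by rewrite !(mulr0, mul0r, addr0, subr0) mulrA mulrAC.
Qed.

Lemma is_diff_conic_map_off u : 0 < rad e u -> is_diff u F (dF u).
Proof.
move=> r0; have dW := is_diff_weight r0; have dr := is_diff_rad e1 r0.
have u0 := rad_gt0_neq0 e1 r0; have B0 := skew_form_gt0 e1 nu ta0 u0.
apply: is_diff_row => j.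
have D := is_diffMf dW (is_diffDf (is_diffMf (is_diffDf
   (is_diffZf al (is_diff_linear u (ax_linear e))) (is_diffZf be dr))
   (is_diff_cstf (e 0 j) u)) (is_diff_linear u (@tr_coord_linear j))).
have -> : (fun v => F v 0 j) =
  (fun v => W v * ((al * ax e v + be * rad e v) * e 0 j + tr e v 0 j)).
  by apply/funext => v; rewrite conic_mapE.
apply: is_diff_eq D _; apply/funext => v; rewrite dconicE.
rewrite /dconic_ax /dangle -/(drad e u v) /GRing.scale/= /cst [X in _ * X]/=.
have -> : dot (tr e u) v = drad e u v * rad e u by rewrite divfK// gt_eqF.
have -> : be = - (k * ta * al) by apply/eqP; rewrite -addr_eq0 addrC kab.
move: B0; rewrite /skew_form /skew_ax.
move: (drad e u v) (rad e u) (ax e u) (W u) => d q b s B0.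
by field; rewrite gt_eqF.
Qed.

Lemma is_diff_conic_map u : u != 0 -> is_diff u F (dF u).
Proof.
move=> u0; have := rad_ge0 e u; rewrite le_eqVlt => /orP[/eqP/esym r0|r0].
  exact: is_diff_conic_map_axis.
exact: is_diff_conic_map_off.
Qed.

(** The only term of [dconic] without an obvious limit on the axis is [drad]
    times the transverse part: a bounded factor times one that vanishes. *)
Lemma continuous_dconic v u : u != 0 -> {for u, continuous (dF ^~ v)}.
Proof.
move=> u0; apply: continuous_row => j.
have cW := continuous_weight u0; have cr := @continuous_rad _ _ e e1 u.
have ca := @continuous_ax _ _ e u.
have ct : {for u, continuous (fun w => tr e w 0 j)}.
  by apply: linear_continuous_row; exact: tr_coord_linear.
have cV : {for u, continuous (fun w => (skew_form e nu ta w)^-1)}.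
  apply: cont_inv; first by rewrite gt_eqF// skew_form_gt0.
  exact: continuous_skew_form.
have cd : {for u, continuous (fun w => dot (tr e w) v)}.
  apply: linear_continuous_row => c w w'.
  by rewrite tr_linear// dotDl dotZl.
have cdt : {for u, continuous (fun w => drad e w v * tr e w 0 j)}.
  have := rad_ge0 e u; rewrite le_eqVlt => /orP[/eqP/esym r0|r0]; last first.
    apply: cont_mul => //; apply: cont_mul => //.
    by apply: cont_inv => //; rewrite gt_eqF.
  apply: (@cont_mul_bounded _ _ (Num.sqrt (dot v v))) => // [|w].
    by move/eqP: r0; rewrite rad_eq0// => /eqP ->; rewrite mxE.
  have [w0|w0] := eqVneq (rad e w) 0.
    by rewrite /drad w0 invr0 mulr0 normr0 sqrtr_ge0.
  have {}w0 : 0 < rad e w by rewrite lt_neqAle eq_sym w0 rad_ge0.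
  rewrite normrM normfV (gtr0_norm w0) ler_pdivrMr// mulrC.
  exact: dot_le_rad.
have -> : (fun w => dF w v 0 j) = (fun w =>
  W w * (al * ax e v
    + be * ((2 * nu + k * ta) * ax e w + (nu ^+ 2 + ta ^+ 2) * rad e w)
        * (skew_form e nu ta w)^-1 * dot (tr e w) v
    + - (k * ta * rad e w * ax e v * (skew_form e nu ta w)^-1
         * (al * ax e w + be * rad e w))) * e 0 j +
  W w * (tr e v 0 j + k * ta * (skew_form e nu ta w)^-1 *
     (ax e w * (drad e w v * tr e w 0 j) +
      - (rad e w * ax e v * tr e w 0 j)))).
  apply/funext => w; rewrite dconicE; congr (_ + _ * (_ + _)).
  by rewrite /dangle; ring.
by prove_continuous.
Qed.

End ConicMapC1.

Lemma dot_dilatel (R : realType) n (x y z : 'rV[R]_n) c :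
  dot (x + c *: z) y = dot x y + c * dot z y.
Proof. by rewrite dotDl dotZl. Qed.

Lemma dot_dilate (R : realType) n (x y z : 'rV[R]_n) c d :
  dot (x + c *: z) (y + d *: z) =
  dot x y + d * dot x z + c * dot z y + c * d * dot z z.
Proof. by rewrite dotDr !dot_dilatel !dotZr; ring. Qed.

(** * Inverses within the family *)

Section ConicInverse.
Context {R : realType} {n : nat}.
Variable e : 'rV[R]_n.
Hypothesis e1 : dot e e = 1.
Implicit Types u v w : 'rV[R]_n.

Section Coordinates.
Variables k al be nu ta : R.
Local Notation W := (weight e k nu ta).
Local Notation F := (conic_map e k al be nu ta).

Let conic_mapD u :
  F u = (W u * (al * ax e u + be * rad e u)) *: e + W u *: tr e u.
Proof. by rewrite /conic_map scalerDr scalerA. Qed.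

Lemma ax_conic_map u : ax e (F u) = W u * (al * ax e u + be * rad e u).
Proof. by rewrite conic_mapD ax_trZ. Qed.

Lemma tr_conic_map u : tr e (F u) = W u *: tr e u.
Proof. by rewrite conic_mapD tr_trZ. Qed.

Lemma rad_conic_map u : rad e (F u) = W u * rad e u.
Proof. by rewrite conic_mapD rad_trZ// expR_ge0. Qed.

Lemma dot_conic_map u v : dot (F u) v =
  W u * ((al * ax e u + be * rad e u) * ax e v + dot (tr e u) v).
Proof.
by rewrite (dot_split e1) ax_conic_map (dot_trl e1) tr_conic_map dotZl; ring.
Qed.

Lemma ax_dconic u v :
  ax e (dconic e k al be nu ta u v) = dconic_ax e k al be nu ta u v.
Proof.
by rewrite /dconic ax_e// {1}/ax dotZl dotDl dotZl -!/(ax e _) !ax_tr// mulr0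
  addr0 mulr0 addr0.
Qed.

Lemma tr_dconic u v : tr e (dconic e k al be nu ta u v) =
  W u *: (tr e v + (k * dangle e nu ta u v) *: tr e u).
Proof. by rewrite {1}/tr ax_dconic /dconic addrC addKr. Qed.

End Coordinates.

(** The constants are matched so that the half plane vectors whose polar angles
    are taken before and after the first map are positively proportional; the
    two weights are then inverse to each other. *)
Lemma conic_mapK (k al be nu ta al' be' nu' ta' : R) u :
  0 < al -> be + nu' = al * nu -> ta' = al * ta ->
  al' * al = 1 -> al' * be + be' = 0 ->
  conic_map e (- k) al' be' nu' ta' (conic_map e k al be nu ta u) = u.
Proof.
move=> al0 Hnu Hta Hal Hbe; set z := conic_map _ k _ _ _ _ u.
pose W := weight e k nu ta u.
have E : skew_angle e nu' ta' z = skew_angle e nu ta u.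
  rewrite /skew_angle /skew_ax /z ax_conic_map rad_conic_map -/W.
  rewrite -(@arg_homog _ (W * al) (ax e u + nu * rad e u));
    last by rewrite mulr_gt0 ?expR_gt0.
  congr arg; last by rewrite Hta; ring.
  have -> : nu' = al * nu - be by rewrite -Hnu addrC addKr.
  by ring.
have WV : weight e (- k) nu' ta' z = W^-1.
  by rewrite /weight E mulNr expRN.
have W0 : W != 0 by rewrite gt_eqF ?expR_gt0.
rewrite {1}/conic_map WV /z.
rewrite ax_conic_map rad_conic_map tr_conic_map -/W scalerDr !scalerA mulVf//.
rewrite scale1r -[RHS](tr_add e u); congr (_ *: _ + _).
rewrite (_ : _ * _ = al' * al * ax e u + (al' * be + be') * rad e u).
  by rewrite Hal Hbe mul1r mul0r addr0.
by field.
Qed.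

End ConicInverse.

(** * The Finsleroid in a Euclidean frame *)

Section Finsleroid.
Context {R : realType} {n : nat}.
Variable e : 'rV[R]_n.
Hypothesis e1 : dot e e = 1.
Variables g h : R.
Hypotheses (h0 : 0 < h) (hg : h ^+ 2 = 1 - g ^+ 2 / 4).
Implicit Types u v w : 'rV[R]_n.

(** The Euclidean gradient of half of K^2. *)
Definition grad_map := conic_map e (- (g / h)) 1 g (g / 2) h.
Definition dgrad := dconic e (- (g / h)) 1 g (g / 2) h.

(** In the plane spanned by the axis and [u], with polar angle [f] counted from
    the axis, an indicatrix vector goes to (cos f, sin f) / h.  The exponential
    weight equals 1 / sqrt B on the indicatrix and makes the map positively
    homogeneous of degree one. *)
Definition sphere_map :=
  conic_map e (- (g / (2 * h))) h^-1 (g / (2 * h)) (g / 2) h.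
Definition dsphere :=
  dconic e (- (g / (2 * h))) h^-1 (g / (2 * h)) (g / 2) h.

Definition sphere_inv := conic_map e (g / (2 * h)) h (- (g / 2)) 0 1.
Definition dsphere_inv := dconic e (g / (2 * h)) h (- (g / 2)) 0 1.

Local Notation q := (rad e).
Local Notation b := (ax e).
Local Notation B := (skew_form e (g / 2) h).
Local Notation E := (weight e (- (g / h)) (g / 2) h).
Local Notation s := (weight e (- (g / (2 * h))) (g / 2) h).

Let hn : h != 0. Proof. by rewrite gt_eqF. Qed.

Lemma finsleroid_formE u : B u = b u ^+ 2 + g * b u * q u + q u ^+ 2.
Proof. by rewrite /skew_form exprMn hg /skew_ax; field. Qed.

Let EsE u : E u = s u ^+ 2.
Proof. by rewrite /weight -expRM_natl; congr expR; field. Qed.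

(** This is K^2, by the Euler identity for the gradient of half of K^2. *)
Lemma dot_grad_map u : dot (grad_map u) u = E u * B u.
Proof. by rewrite dot_conic_map// finsleroid_formE -rad_sqr//; ring. Qed.

Lemma dot_sphere_map u :
  dot (sphere_map u) (sphere_map u) = dot (grad_map u) u / h ^+ 2.
Proof.
rewrite dot_grad_map (dot_split e1) (dot_trl e1) ax_conic_map// tr_conic_map//.
rewrite dotZl -(dot_trl e1) tr_conic_map// dotZr (dot_trl e1) -rad_sqr//.
rewrite EsE /skew_form exprMn /skew_ax; move: (s u) (b u) (q u) => S x y.
by field.
Qed.

Lemma sphere_mapK u : sphere_inv (sphere_map u) = u.
Proof.
rewrite /sphere_inv -[X in conic_map _ X]opprK; apply: conic_mapK => //.
- by rewrite invr_gt0.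
- by field.
- by rewrite mulVf.
- by rewrite divff.
- by field.
Qed.

Lemma sphere_invK u : sphere_map (sphere_inv u) = u.
Proof.
apply: conic_mapK => //.
- by rewrite addNr mulr0.
- by rewrite mulr1.
- by rewrite mulVf.
- by field.
Qed.

Lemma is_diff_grad_map u : u != 0 -> is_diff u grad_map (dgrad u).
Proof. by move=> u0; apply: is_diff_conic_map => //; field. Qed.

Lemma is_diff_sphere_map u : u != 0 -> is_diff u sphere_map (dsphere u).
Proof. by move=> u0; apply: is_diff_conic_map => //; field. Qed.

Lemma continuous_dsphere v u : u != 0 -> {for u, continuous (dsphere ^~ v)}.
Proof. by move=> u0; apply: continuous_dconic => //; field. Qed.

Lemma is_diff_sphere_inv u : u != 0 -> is_diff u sphere_inv (dsphere_inv u).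
Proof. by move=> u0; apply: is_diff_conic_map => //; field. Qed.

Lemma continuous_dsphere_inv v u : u != 0 ->
  {for u, continuous (dsphere_inv ^~ v)}.
Proof. by move=> u0; apply: continuous_dconic => //; field. Qed.

(** The Hessian is symmetric and the gradient is homogeneous of degree one. *)
Lemma dot_dgrad_radial u v : u != 0 -> dot (dgrad u v) u = dot (grad_map u) v.
Proof.
move=> u0; have := skew_form_gt0 e1 (g / 2) h0 u0.
rewrite finsleroid_formE => B0.
rewrite dot_conic_map// (dot_split e1) (dot_trl e1) ax_dconic// tr_dconic//.
rewrite dotZl dotDl dotZl -rad_sqr//.
rewrite -[dot (tr e v) u](dot_trl e1) dotC (dot_trl e1).
rewrite /dconic_ax /dangle /drad finsleroid_formE.
have [q0|q0] := eqVneq (q u) 0.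
  have := rad0_ax_neq0 e1 u0 q0; rewrite q0 invr0.
  move: (dot (tr e u) v) (ax e v) (b u) (E u) => d x y S y0.
  by field; rewrite hn y0.
have -> : h ^+ 2 = 1 - g ^+ 2 / 4 := hg.
move: (dot (tr e u) v) (ax e v) B0 q0 => d x.
by move: (b u) (E u) (q u) => y S r B0 q0; field; rewrite (gt_eqF B0) hn q0.
Qed.

(** By the product rule, [dot_dgrad_radial] being the half that comes from the
    derivative of the gradient. *)
Lemma is_diff_finsleroid_sqr u : u != 0 ->
  is_diff u (fun u => dot (grad_map u) u) (fun v => 2 * dot (grad_map u) v).
Proof.
move=> u0; have dL := is_diff_grad_map u0.
have co (f df : 'rV[R]_n -> 'rV[R]_n) j : is_diff u f df ->
  is_diff u (fun w => f w 0 j) (fun w => df w 0 j).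
  by move=> df'; exact: (is_diff_comp df' (is_diff_coord j (f u))).
have := is_diff_sum (index_enum 'I_n) (fun j =>
  is_diffMf (co _ _ j dL) (co _ _ j (is_diff_id u))).
move=> D; apply: is_diff_eq D _; apply/funext => v.
rewrite big_split/= -!/(dot _ _) dot_dgrad_radial//; ring.
Qed.

(** For a vector tangent to a level set of K, with axial component [x], the
    transverse variation is determined by [x]: off the axis
    [q * drad = - (b + g * q) * x], so the polar angle turns by
    [- h * x / q].  Then [dsphere] has axial component [s * h * x] and [dgrad]
    has [E * x]; both sides are explicit and agree because
    [h ^+ 2 = 1 - g ^+ 2 / 4] and [E = s ^+ 2].  On the axis [x = 0] and both
    differentials are multiples of the transverse part. *)
Lemma dot_dsphere u v w : u != 0 ->
  dot (grad_map u) v = 0 -> dot (grad_map u) w = 0 ->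
  dot (dsphere u v) (dsphere u w) = dot (dgrad u v) w.
Proof.
move=> u0; have := skew_form_gt0 e1 (g / 2) h0 u0.
rewrite finsleroid_formE => B0.
have E0 : E u != 0 by rewrite gt_eqF// expR_gt0.
rewrite !dot_conic_map// => /eqP.
rewrite mulf_eq0 (negbTE E0)/= mul1r => /eqP Hv.
move=> /eqP; rewrite mulf_eq0 (negbTE E0)/= => /eqP Hw.
rewrite (dot_split e1) [RHS](dot_split e1) !ax_dconic// !tr_dconic//.
rewrite [dot (s u *: _) _]dotZl [dot _ (s u *: _)]dotZr.
rewrite [dot (_ *: _) (tr e w)]dotZl dot_dilate dot_dilatel.
rewrite (dotC (tr e v) (tr e u)).
rewrite ![dot (tr e u) (tr e _)](dot_trl e1) -(rad_sqr e1 u) EsE.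
move: {E0} (dot (tr e v) (tr e w)) => m.
rewrite /dconic_ax /dangle /drad EsE finsleroid_formE.
have -> : dot (tr e u) v = - ((b u + g * q u) * b v).
  by apply/eqP; rewrite -addr_eq0 addrC Hv.
have -> : dot (tr e u) w = - ((b u + g * q u) * b w).
  by apply/eqP; rewrite -addr_eq0 addrC Hw.
have [q0|q0] := eqVneq (q u) 0.
  have y0 := rad0_ax_neq0 e1 u0 q0.
  have x0 z : (b u + g * q u) * b z + dot (tr e u) z = 0 -> b z = 0.
    have : tr e u == 0 by rewrite -rad_eq0// q0.
    move=> /eqP ->; rewrite q0 mulr0 addr0 dot0l.
    by rewrite addr0 => /eqP; rewrite mulf_eq0 (negbTE y0) => /eqP.
  by rewrite (x0 _ Hv) (x0 _ Hw) q0; ring.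
move: (b u) (q u) (s u) (b v) (b w) B0 q0 => y r S x z B0 q0 {Hv Hw}.
set D := y ^+ 2 + g * y * r + r ^+ 2 in B0 *.
have Dn : D != 0 by rewrite gt_eqF.
have turn t : h * (y * (- ((y + g * r) * t) / r) - r * t) / D = - (h * t / r).
  by rewrite /D in Dn *; field; rewrite Dn q0.
have axial t : h^-1 * t + g / (2 * h) * ((2 * (g / 2) + - (g / (2 * h)) * h) * y
    + ((g / 2) ^+ 2 + h ^+ 2) * r) / D * - ((y + g * r) * t)
    - - (g / (2 * h)) * h * r * t / D * (h^-1 * y + g / (2 * h) * r) = h * t.
  have -> : h * t = h^-1 * h ^+ 2 * t by field.
  by rewrite hg /D in Dn *; field; rewrite Dn hn.
have axial' : 1 * x + g * ((2 * (g / 2) + - (g / h) * h) * y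
    + ((g / 2) ^+ 2 + h ^+ 2) * r) / D * - ((y + g * r) * x)
    - - (g / h) * h * r * x / D * (1 * y + g * r) = x.
  by rewrite hg /D in Dn *; field; rewrite Dn hn.
rewrite !axial axial' !turn.
have -> : S * (h * x) * (S * (h * z)) = S ^+ 2 * (1 - g ^+ 2 / 4) * x * z.
  by rewrite -hg; ring.
by field; rewrite hn q0.
Qed.

End Finsleroid.

(** * Orthonormal frames *)

(** Cholesky factorisation, by induction on the size: the Schur complement of
    the upper left entry is again positive definite, its value at [w] being the
    minimum of the quadratic form over the vectors with last components [w]. *)
Lemma cholesky (R : realType) n (A : 'M[R]_n) : posdef A ->
  exists P, P \in unitmx /\ A = P *m P^T.
Proof.
elim: n A => [|n IH] A [symA posA].
  exists 1%:M; rewrite unitmx1; split => //.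
  by rewrite [A]flatmx0 [RHS]flatmx0.
pose A' : 'M[R]_(1 + n) := A.
pose al := A' 0 0; pose r := ursubmx A'; pose D := drsubmx A'.
have EA : A' = block_mx al%:M r r^T D.
  rewrite -[LHS]submxK; congr block_mx.
    by rewrite [LHS]mx11_scalar !mxE !lshift0.
  by rewrite /r trmx_ursub symA.
have symD : D^T = D by rewrite /D trmx_drsub symA.
have {}posA : forall v : 'rV[R]_(1 + n), v != 0 -> 0 < @bilin R (1 + n) A' v v.
  exact: posA.
have {}symA : A'^T = A' := symA.
have quad (t : 'M[R]_1) (w : 'rV[R]_n) :
    @bilin R (1 + n) A' (row_mx t w) (row_mx t w) =
    (al *: (t *m t^T) + w *m r^T *m t^T + (t *m r *m w^T + w *m D *m w^T)) 0 0.
  rewrite /bilin EA mul_row_block tr_row_mx mul_row_col mul_mx_scalar.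
  by rewrite !mulmxDl -scalemxAl.
have al0 : 0 < al.
  have : row_mx 1%:M 0 != 0 :> 'rV[R]_(1 + n).
    apply/eqP => /(congr1 lsubmx); rewrite row_mxKl => /matrixP/(_ 0 0).
    by rewrite !mxE => /eqP; rewrite oner_eq0.
  move=> /posA; rewrite quad !mul0mx trmx0 mulmx0 !addr0 trmx1 mulmx1.
  by rewrite !mxE mulr1.
pose S := D - al^-1 *: (r^T *m r).
have [|P [uP EP]] := IH S.
  split; first by rewrite linearB linearZ/= trmx_mul trmxK symD.
  move=> w w0; pose t : 'M[R]_1 := - (al^-1 *: (w *m r^T)).
  have : row_mx t w != 0.
    apply: contra_neq w0 => /(congr1 rsubmx).
    by rewrite row_mxKr => ->; rewrite linear0.
  have tT : t^T = - (al^-1 *: (r *m w^T)).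
    by rewrite linearN linearZ/= trmx_mul trmxK.
  move=> /posA; rewrite quad tT /t /bilin.
  rewrite !(mulNmx, mulmxN) opprK -!scalemxAl -!scalemxAr !scalerA.
  rewrite /S mulmxBr mulmxBl -!scalemxAr -!scalemxAl !mulmxA.
  rewrite divff ?gt_eqF// mul1r addrC addrA.
  by rewrite addrK addrC.
pose s := Num.sqrt al.
have s0 : s != 0 by rewrite gt_eqF ?sqrtr_gt0.
suff : exists Q : 'M[R]_(1 + n), Q \in unitmx /\ A' = Q *m Q^T by [].
exists (block_mx s%:M 0 (s^-1 *: r^T) P); split.
  rewrite unitmxE det_lblock det_scalar1 unitrM unitfE s0/=.
  by rewrite -unitmxE.
rewrite EA tr_block_mx mulmx_block trmx0 !mulmx0 !mul0mx !addr0.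
rewrite tr_scalar_mx -scalar_mxM -expr2 sqr_sqrtr ?(ltW al0)//.
rewrite linearZ/= trmxK mul_scalar_mx mul_mx_scalar !scalerA divff// !scale1r.
congr block_mx; rewrite -scalemxAl -scalemxAr scalerA -invfM -expr2.
by rewrite sqr_sqrtr ?(ltW al0)// -EP /S addrC subrK.
Qed.

(** * The Finsleroid of a positive definite form and a unit covector *)

Lemma dotE (R : realType) n (u v : 'rV[R]_n) : dot u v = (u *m v^T) 0 0.
Proof. by rewrite mxE; apply: eq_bigr => i _; rewrite mxE. Qed.

Lemma open_neq0 (R : realType) m : open [set y : 'rV[R]_m | y != 0].
Proof.
have -> : [set y : 'rV[R]_m | y != 0] = ~` [set 0].
  by apply/seteqP; split => y /=; [move=> /eqP|move=> ?; apply/eqP].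
apply/closed_openC/accessible_closed_set1/hausdorff_accessible.
exact: norm_hausdorff.
Qed.

Lemma near_neq0 (R : realType) m (y : 'rV[R]_m) :
  y != 0 -> \forall z \near y, z != 0.
Proof. by move=> y0; exact: (open_neq0 y0). Qed.

Lemma mulmx_linear (R : realType) m k (Q : 'M[R]_(m, k)) :
  linear (fun y : 'rV[R]_m => y *m Q).
Proof. by move=> c u v; rewrite mulmxDl -scalemxAl. Qed.

Lemma is_diff_comp_mulmx (R : realType) n (W : normedModType R) (P : 'M[R]_n)
    (f df : 'rV[R]_n -> W) (y : 'rV[R]_n) :
  is_diff (y *m P) f df ->
  is_diff y (fun z => f (z *m P)) (fun v => df (v *m P)).
Proof.
by move=> dfy; exact: (is_diff_comp (is_diff_linear y (mulmx_linear P)) dfy).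
Qed.

Section FinsleroidInFrame.
Context {R : realType} {n : nat}.
Variables (a P : 'M[R]_n) (b : 'rV[R]_n) (g : R).
Hypotheses (uP : P \in unitmx) (aP : a = P *m P^T).
Hypothesis b1 : covector_sqnorm a b = 1.
Hypothesis g2 : -2 < g < 2.

(* [y |-> y *m P] is an isometry from the form [a] to the dot product, and it
   carries the covector [b] to [dot ^~ e]. *)
Let e := b *m (invmx P)^T.
Let h := fins_h g.

Lemma fins_h_gt0 : 0 < h.
Proof. by rewrite sqrtr_gt0 subr_gt0; move: g2 => /andP[? ?]; nra. Qed.

Lemma fins_h_sqr : h ^+ 2 = 1 - g ^+ 2 / 4.
Proof. by rewrite sqr_sqrtr// ltW// -sqrtr_gt0; exact: fins_h_gt0. Qed.

Lemma frame_unit : dot e e = 1.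
Proof.
have ua : a \in unitmx by rewrite aP unitmx_mul uP unitmx_tr.
have Er : raise_index a b = b *m (invmx a)^T.
  by apply/rowP => i; rewrite !mxE; apply: eq_bigr => j _; rewrite mxE mulrC.
rewrite -b1 /covector_sqnorm /bilin Er dotE /e !trmx_mul !trmxK !mulmxA.
congr (fun_of_matrix _ 0 0); congr (_ *m _).
have aT : a^T = a by rewrite aP trmx_mul trmxK.
rewrite (trmx_inv a) aT (mulmxKV ua) -!mulmxA; congr (_ *m _).
rewrite trmx_inv; apply: (can_inj (mulmxK ua)); rewrite mulVmx// {1}aP.
by rewrite mulmxA mulmxKV// mulVmx// unitmx_tr.
Qed.

Lemma fins_b_frame y : fins_b b y = ax e (y *m P).
Proof.
transitivity (dot b y); first by [].
by rewrite dotC /ax !dotE /e trmx_mul trmxK mulmxA mulmxK.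
Qed.

Lemma fins_q_frame y : fins_q a b y = rad e (y *m P).
Proof.
rewrite /fins_q /rad; congr Num.sqrt.
rewrite (dot_trl frame_unit) dot_tr -fins_b_frame.
under eq_bigr do under eq_bigr do rewrite 2!mulrBl.
under eq_bigr do rewrite big_split/= sumrN.
rewrite big_split/= sumrN; congr (_ - _).
  rewrite dotE trmx_mul mulmxA -(mulmxA y) -aP mxE exchange_big/=.
  apply: eq_bigr => j _; rewrite !mxE mulr_suml.
  by apply: eq_bigr => i _; rewrite [a i j * _]mulrC.
rewrite /fins_b mulr_suml; apply: eq_bigr => i _.
by rewrite mulr_sumr; apply: eq_bigr => j _; ring.
Qed.

Lemma fins_K_sqr y :
  fins_K a b g y ^+ 2 = dot (grad_map e g h (y *m P)) (y *m P).
Proof.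
have h0 := fins_h_gt0; have hg := fins_h_sqr.
rewrite (dot_grad_map frame_unit)//; set u := y *m P.
have EB : fins_B a b g y = skew_form e (g / 2) h u.
  by rewrite finsleroid_formE// /fins_B fins_b_frame fins_q_frame.
rewrite /fins_K exprMn EB sqr_sqrtr ?addr_ge0 ?sqr_ge0// mulrC; congr (_ * _).
rewrite -expRM_natl; congr expR.
rewrite /fins_chi /fins_f EB /fins_A fins_b_frame fins_q_frame -/u -/h.
have -> : acos ((ax e u + g * rad e u / 2) / Num.sqrt (skew_form e (g / 2) h u))
  = skew_angle e (g / 2) h u.
  by rewrite [g * _ / 2]mulrAC.
by field; rewrite gt_eqF.
Qed.

Lemma fins_K_ge0 y : 0 <= fins_K a b g y.
Proof. by rewrite mulr_ge0 ?sqrtr_ge0 ?expR_ge0. Qed.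

Lemma indicatrixP y : fins_indicatrix a b g y <->
  dot (grad_map e g h (y *m P)) (y *m P) = 1.
Proof.
rewrite -fins_K_sqr /fins_indicatrix /=.
split => [->|]; first by rewrite expr1n.
move=> /eqP; rewrite sqrf_eq1 => /orP[/eqP//|/eqP K1].
by have := fins_K_ge0 y; rewrite K1 ler0N1.
Qed.

Lemma frame_neq0 (y : 'rV[R]_n) : (y *m P != 0) = (y != 0).
Proof.
apply/idP/idP; apply: contra_neq; first by move=> ->; rewrite mul0mx.
by move=> yP; rewrite -(mulmxK uP y) yP mul0mx.
Qed.

(** The Finslerian metric tensor is the Hessian of half of K^2, hence the
    differential of [grad_map]. *)
Lemma fins_metric_frame y v w : y != 0 ->
  bilin (fins_metric a b g y) v w =
  dot (dgrad e g h (y *m P) (v *m P)) (w *m P).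
Proof.
move=> y0; have h0 := fins_h_gt0; have hg := fins_h_sqr; have e1 := frame_unit.
have yP0 : y *m P != 0 by rewrite frame_neq0.
pose L z := grad_map e g h (z *m P); pose dL z := dgrad e g h (y *m P) (z *m P).
have D1 z j : z != 0 -> 'D_(delta_mx 0 j) (fun w => fins_K a b g w ^+ 2) z =
    2 * dot (L z) (delta_mx 0 j *m P).
  rewrite -frame_neq0 => z0.
  have -> : (fun w => fins_K a b g w ^+ 2) =
    (fun u => dot (grad_map e g h u) u) \o mulmxr P.
    by apply/funext => t; rewrite fins_K_sqr.
  have := is_diff_comp (is_diff_linear z (mulmx_linear P))
     (is_diff_finsleroid_sqr e1 h0 hg z0).
  by move=> /(is_diff_derive (delta_mx 0 j))[_ ->].
have dLy : is_diff y L dL.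
  exact: is_diff_comp_mulmx (is_diff_grad_map e1 g h0 yP0).
have GE i j : fins_metric a b g y i j =
    dot (dL (delta_mx 0 i)) (delta_mx 0 j *m P).
  rewrite mxE (@near_eq_derive _ _ _ _
    (fun z => 2 * dot (L z) (delta_mx 0 j *m P))); last first.
    by apply: filterS (near_neq0 y0) => z; exact: D1.
  have := is_diff_comp dLy (is_diff_linear _ (dot_linear (delta_mx 0 j *m P))).
  move=> /(is_diffZf 2)/(is_diff_derive (delta_mx 0 i))[_ ->].
  by rewrite /= mulrC mulKf.
have lin : linear dL.
  by move=> c u u'; case: dLy => _ <-; rewrite linearP.
pose M := GRing.isLinear.Build _ _ _ _ _ lin.
pose dLL : {linear _ -> _} := HB.pack dL M.
have -> : dgrad e g h (y *m P) (v *m P) = \sum_i v 0 i *: dL (delta_mx 0 i).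
  rewrite -/(dL v) {1}(row_decomp v) -[dL]/(dLL : _ -> _) linear_sum.
  by apply: eq_bigr => i _; rewrite linearZ.
rewrite {2}(row_decomp w) mulmx_suml.
rewrite /bilin mxE.
have dot_suml (f : 'I_n -> 'rV[R]_n) z :
    dot (\sum_i f i) z = \sum_i dot (f i) z.
  by elim/big_rec2 : _ => [|i s1 s2 _ <-]; rewrite ?dotDl ?dot0l.
rewrite dotC dot_suml; apply: eq_bigr => j _.
rewrite -scalemxAl dotZl dotC dot_suml !mxE mulrC; congr (_ * _).
by apply: eq_bigr => i _; rewrite dotZl GE.
Qed.

Lemma sphereP m (r : R) (z : 'rV[R]_m) : 0 < r ->
  euclidean_sphere r z <-> dot z z = r ^+ 2.
Proof.
move=> r0; rewrite /euclidean_sphere /=.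
have -> : \sum_i z 0 i ^+ 2 = dot z z.
  by apply: eq_bigr => i _; rewrite expr2.
split=> [<-|->]; first by rewrite sqr_sqrtr// dot_ge0.
by rewrite sqrtr_sqr gtr0_norm.
Qed.

Lemma finsleroid_isometric :
  globally_isometric (fins_indicatrix a b g) (fins_metric a b g)
    (@euclidean_sphere R n (1 / fins_h g)) (@euclidean_metric R n).
Proof.
have h0 := fins_h_gt0; have hg := fins_h_sqr; have e1 := frame_unit.
have r0 : 0 < 1 / fins_h g by rewrite divr_gt0.
have ind0 y : fins_indicatrix a b g y -> y != 0.
  move/indicatrixP; apply: contra_eq_neq => ->.
  by rewrite mul0mx dot0r eq_sym oner_eq0.
have sph0 z : @euclidean_sphere R n (1 / fins_h g) z -> z != 0.
  move/(sphereP _ r0); apply: contra_eq_neq => ->.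
  by rewrite dot0l eq_sym expf_neq0// gt_eqF.
pose phi y := sphere_map e g h (y *m P).
pose psi z := sphere_inv e g h z *m invmx P.
have phiK y : psi (phi y) = y.
  by rewrite /psi /phi sphere_mapK// mulmxK.
have psiK z : phi (psi z) = z.
  by rewrite /psi /phi mulmxKV// sphere_invK.
have norm_phi y : dot (phi y) (phi y) =
    dot (grad_map e g h (y *m P)) (y *m P) / h ^+ 2.
  exact: dot_sphere_map.
have h2 : h ^+ 2 != 0 by rewrite expf_neq0// gt_eqF.
have r2 : (1 / fins_h g) ^+ 2 = 1 / h ^+ 2 by rewrite expr_div_n expr1n.
have dphi y : y != 0 ->
    is_diff y phi (fun v => dsphere e g h (y *m P) (v *m P)).
  rewrite -frame_neq0 => y0.
  exact: (is_diff_comp_mulmx (is_diff_sphere_map e1 g h0 y0)).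
exists phi, psi; split.
- move=> y Iy; split=> //; apply/(sphereP _ r0).
  by rewrite norm_phi r2; congr (_ / _); exact/indicatrixP.
- move=> z Sz; split=> //; apply/indicatrixP.
  have := norm_phi (psi z); rewrite psiK.
  move/(sphereP _ r0): Sz => ->; rewrite r2 => /(congr1 ( *%R^~ (h ^+ 2))).
  by rewrite !divfK// => <-.
- move=> y Iy; exists [set y | y != 0], phi; split;
    [exact: open_neq0|exact: ind0| |by []].
  apply: class_C1_is_diff dphi (@open_neq0 _ _) _ => v p p0.
  have cD : {for p *m P, continuous (fun q => dsphere e g h q (v *m P))}.
    by apply: continuous_dsphere => //; rewrite frame_neq0.
  have cP := @linear_continuous_row _ _ _ _ p (mulmx_linear P).
  have := cont_comp cP cD; exact.
- move=> z Sz; exists [set y | y != 0], psi; split;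
    [exact: open_neq0|exact: sph0| |by []].
  apply: (@class_C1_is_diff _ _ _ _ _
    (fun p v => dsphere_inv e g h p v *m invmx P)) (@open_neq0 _ _) _.
    move=> p p0; have := is_diff_comp (is_diff_sphere_inv e1 g h0 p0)
      (is_diff_linear _ (mulmx_linear (invmx P))).
    exact.
  move=> v p p0.
  have cD : {for p, continuous (dsphere_inv e g h ^~ v)}.
    exact: continuous_dsphere_inv.
  have cQ := @linear_continuous_row _ _ _ _ (dsphere_inv e g h p v)
    (mulmx_linear (invmx P)).
  have := cont_comp cD cQ; exact.
move=> y c1 c2 Iy [c10 Sc1 dc1] [c20 Sc2 dc2].
have y0 := ind0 _ Iy.
have yP0 : y *m P != 0 by rewrite frame_neq0.
have D (c : R -> 'rV[R]_n) : c 0 = y -> derivable c 0 1 ->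
    derive1 (phi \o c) 0 = dsphere e g h (y *m P) (derive1 c 0 *m P).
  by move=> c0 dc; rewrite (derive1_comp_curve c0 (dphi _ y0) dc).
(* K is constant along a curve of the indicatrix, so its velocity is tangent. *)
have T (c : R -> 'rV[R]_n) : c 0 = y ->
    (forall t, fins_indicatrix a b g (c t)) ->
    derivable c 0 1 -> dot (grad_map e g h (y *m P)) (derive1 c 0 *m P) = 0.
  move=> c0 Sc dc.
  have DK := is_diff_comp_mulmx (is_diff_finsleroid_sqr e1 h0 hg yP0).
  have := derive1_comp_curve c0 DK dc.
  have -> : (fun z => dot (grad_map e g h (z *m P)) (z *m P)) \o c = cst 1.
    by apply/funext => t; apply/indicatrixP; exact: Sc.
  rewrite derive1_cst => /esym/eqP; rewrite mulf_eq0 pnatr_eq0/= => /eqP.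
  exact.
rewrite !D// fins_metric_frame// /bilin /euclidean_metric mulmx1 -dotE.
by apply: dot_dsphere => //; exact: T.
Qed.

End FinsleroidInFrame.

Theorem mainTheorem13 (R : realType) (N : nat) (M : smooth_manifold R N)
    (a : riemannian_metric M) (b : one_form M) (g : M -> R)
    (hb : forall (i : chart M) (x : M), dom i x ->
            covector_sqnorm (a i x) (b i x) = 1)
    (hg : forall x : M, -2 < g x < 2)
    (x : M) (i : chart M) (hx : dom i x) :
  globally_isometric
    (fins_indicatrix (a i x) (b i x) (g x))
    (fins_metric (a i x) (b i x) (g x))
    (@euclidean_sphere R N (1 / fins_h (g x)))
    (@euclidean_metric R N).
Proof.
have [P [uP aP]] := cholesky (rm_posdef a hx).
exact: finsleroid_isometric uP aP (hb i x hx) (hg x).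
Qed.
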